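(* Let $w\in\mathbb{C}$ with $-w\notin\mathbb{N}\cup\{0\}$ (that is, $w\notin\{0,-1,-2,\dots\}$), and let $q=\exp(-\pi\tau)$ with $\tau>0$. Then $$\Gamma_{q}(w)=\Gamma(w)\left\{1+\mathcal{O}(\tau)\right\}$$ as $\tau\to0^{+}$.
   Context: For $q\in(0,1)$ and $a\in\mathbb{C}$, $(a;q)_{\infty}=\prod_{k=0}^{\infty}(1-aq^{k})$. The $q$-Gamma function is $$\Gamma_{q}(z)=\frac{(q;q)_{\infty}}{(1-q)^{z-1}(q^{z};q)_{\infty}},$$ where for $q=e^{-\pi\tau}$ one has $q^{z}=e^{-\pi\tau z}$, and $(1-q)^{z-1}=\exp((z-1)\log(1-q))$ with the real logarithm of $1-q>0$. $\Gamma$ is the Euler Gamma function. The asymptotic statement is for fixed $w$ as $\tau\to0^{+}$ (the implied constant may depend on $w$). *)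

(* Defs.v *)
From Stdlib Require Import Reals.
From Coquelicot Require Import Coquelicot.

Open Scope C_scope.

Definition Cexp (z : C) : C := RtoC (exp (Re z)) * (cos (Im z), sin (Im z)).

(* x^z for a real base x > 0, with the real logarithm of x.
   In particular, for x = exp (- (PI * tau)) it is Cexp (- (PI * tau) * z). *)
Definition Rcpow (x : R) (z : C) : C := Cexp (z * RtoC (ln x)).

Fixpoint Cprod (f : nat -> C) (n : nat) : C :=
  match n with
  | O => 1
  | S m => Cprod f m * f m
  end.

(* The limit of the partial products; unspecified if they diverge. *)
Definition Cinfprod (f : nat -> C) : C :=
  iota (fun l : C_CompleteNormedModule =>
    filterlim (Cprod f) eventually (locally l)).

Definition qPochhammer (a : C) (q : R) : C :=
  Cinfprod (fun k => 1 - a * RtoC (q ^ k)).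

Definition qGamma (q : R) (z : C) : C :=
  qPochhammer (RtoC q) q
    / (Rcpow (1 - q) (z - 1) * qPochhammer (Rcpow q z) q).

(* Euler's product, valid on the whole plane:
   1 / Gamma(z) = z * prod_{j >= 1} (1 + z / j) (1 + 1 / j)^(-z).
   The factor of index k below is the one with j = k + 1. *)
Definition Gamma (z : C) : C :=
  / (z * Cinfprod (fun k =>
           (1 + z / RtoC (INR (S k))) * Rcpow (1 + / INR (S k)) (- z))).

(* f = O(g) along the filter F. *)
Definition is_bigO (F : (R -> Prop) -> Prop) (f : R -> C) (g : R -> R) : Prop :=
  exists K : R, F (fun t => (Cmod (f t) <= K * Rabs (g t))%R).

(* Main.v *)
Require Import Defs.
From Stdlib Require Import Reals Lra Lia Psatz.
From Coquelicot Require Import Coquelicot.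

(** Write s = pi tau and q = exp (- s).  The q-Gamma function has an Euler
    product of the same shape as the one that defines Gamma: up to the prefactor
    [w]_q = (1 - q ^ w) / (1 - q), the reciprocal of Gamma_q (w) is the product
    over j >= 1 of
<<
      (1 - q ^ (w + j)) / (1 - q ^ j) * ([j]_q / [j + 1]_q) ^ w,
>>
    because the powers telescope to (1 - q) ^ w ([factor_identity],
    [product_identity]).  Hence Gamma / Gamma_q is [w]_q / w times the product of
    the quotients R_j of these factors by those of Gamma ([qGamma_Gamma]), and
    everything reduces to the estimate
<<
      |R_j - 1| <= K s ^ 2 / (1 + j s) ^ 2        (quotient_factor_bound)
>>
    uniformly in j >= 1 and small s.  Comparing the sum over j with a telescoping
    one shows that it is at most K s, so the product of the R_j is 1 + O(s)
    ([quotient_product_limit]); the prefactor is elementary ([qnumber_bound]).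

    For the estimate, let F x = (1 - exp (- x)) / x and x = j s.  Then
    R_j = F (x + w s) / F x * (F (x + s) / F x) ^ (- w).  Both quotients are
    instances of F (x + d) / F x = 1 + d g x + O(|d| ^ 2 / (1 + x) ^ 2), where
    g x = 1 / (exp x - 1) - 1 / x is the logarithmic derivative of F
    ([shift_ratio_bound]); the poles at x = 0 cancel and g x = O(1 / (1 + x)).
    The terms of first order, w s g x and - w s g x, cancel in R_j
    ([cancel_first_order]).  The same cancellation, with 1 / j in place of
    s g x, shows that Euler's product for 1 / Gamma converges to a nonzero limit.
    The hypothesis on w is used to bound |1 + w / j| from below, uniformly in j
    ([one_plus_div_lower]). *)

Open Scope C_scope.

(** * The complex exponential *)

Lemma Cexp_plus (a b : C) : Cexp (a + b) = Cexp a * Cexp b.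
Proof.
  destruct a as [a1 a2], b as [b1 b2]; unfold Cexp; simpl.
  rewrite exp_plus, cos_plus, sin_plus, RtoC_mult.
  apply injective_projections; simpl; ring.
Qed.

Lemma Cexp_RtoC (r : R) : Cexp (RtoC r) = RtoC (exp r).
Proof.
  unfold Cexp; simpl; rewrite cos_0, sin_0.
  apply injective_projections; simpl; ring.
Qed.

Lemma Cexp_0 : Cexp 0 = 1.
Proof. now rewrite Cexp_RtoC, exp_0. Qed.

Lemma Cmod_Cexp (z : C) : Cmod (Cexp z) = exp (Re z).
Proof.
  unfold Cexp; rewrite Cmod_mult, Cmod_R, (Rabs_pos_eq (exp _)).
  2: left; apply exp_pos.
  replace (Cmod _) with 1%R; [ring|].
  unfold Cmod; simpl.
  replace (_ + _)%R with 1%R; [now rewrite sqrt_1|].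
  generalize (sin2_cos2 (Im z)); unfold Rsqr; lra.
Qed.

Lemma exp_mono (a b : R) : (a <= b)%R -> (exp a <= exp b)%R.
Proof.
  intros [lt | ->]; [left; now apply exp_increasing | apply Rle_refl].
Qed.

Lemma Cmod_Cexp_le (z : C) : (Cmod (Cexp z) <= exp (Cmod z))%R.
Proof.
  rewrite Cmod_Cexp; apply exp_mono.
  eapply Rle_trans; [apply Rle_abs | apply re_le_Cmod].
Qed.

Lemma Cmod_sub_le (a b : C) : (Cmod (a - b) <= Cmod a + Cmod b)%R.
Proof. unfold Cminus; rewrite <- (Cmod_opp b); apply Cmod_triangle. Qed.

(** The mean value equality fails for complex-valued functions, but it holds for
    the real function obtained by pairing [H] with the constant vector
    [H 1 - H 0]; Cauchy-Schwarz then gives the inequality. *)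
Lemma mean_value_ineq (H H' : R -> C) (M : R) :
  (forall t, is_derive (fun t => Re (H t)) t (Re (H' t))) ->
  (forall t, is_derive (fun t => Im (H t)) t (Im (H' t))) ->
  (forall t, (0 <= t <= 1)%R -> (Cmod (H' t) <= M)%R) ->
  (Cmod (H 1%R - H 0%R) <= M)%R.
Proof.
  intros dRe dIm bound.
  set (v := H 1%R - H 0%R).
  destruct (MVT_gen (fun t => Re (H t) * Re v + Im (H t) * Im v)%R 0 1
              (fun t => Re (H' t) * Re v + Im (H' t) * Im v)%R)
    as [c [hc eq]].
  - intros t _.
    apply (is_derive_plus (V := R_NormedModule)
             (fun t => Re (H t) * Re v)%R (fun t => Im (H t) * Im v)%R t
             (Re (H' t) * Re v)%R (Im (H' t) * Im v)%R).
    + apply (is_derive_ext (fun t => Re v * Re (H t))%R);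
        [intros; apply Rmult_comm|].
      rewrite Rmult_comm; apply is_derive_scal, dRe.
    + apply (is_derive_ext (fun t => Im v * Im (H t))%R);
        [intros; apply Rmult_comm|].
      rewrite Rmult_comm; apply is_derive_scal, dIm.
  - intros t _.
    apply continuity_pt_plus; apply continuity_pt_mult;
      try (apply continuity_pt_const; intros ? ?; reflexivity);
      apply continuity_pt_filterlim;
      apply (ex_derive_continuous (V := R_NormedModule));
      eexists; [apply dRe | apply dIm].
  - rewrite Rmin_left, Rmax_right in hc by lra.
    specialize (bound c hc).
    assert (sq : forall z : C, (Cmod z * Cmod z = Re z * Re z + Im z * Im z)%R).
    { intros z; generalize (Cmod2_alt z); simpl; lra. }
    assert (cs : (Re (H' c) * Re v + Im (H' c) * Im v
                  <= Cmod (H' c) * Cmod v)%R).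
    { apply Rsqr_incr_0_var;
        [|apply Rmult_le_pos; apply Cmod_ge_0].
      unfold Rsqr.
      replace (Cmod (H' c) * Cmod v * (Cmod (H' c) * Cmod v))%R
        with ((Cmod (H' c) * Cmod (H' c)) * (Cmod v * Cmod v))%R by ring.
      rewrite !sq.
      generalize (Rle_0_sqr (Re (H' c) * Im v - Im (H' c) * Re v)).
      unfold Rsqr; lra. }
    assert (eq' : (Cmod v * Cmod v = Re (H' c) * Re v + Im (H' c) * Im v)%R).
    { rewrite sq.
      replace (Re v) with (Re (H 1%R) - Re (H 0%R))%R at 1 by reflexivity.
      replace (Im v) with (Im (H 1%R) - Im (H 0%R))%R at 1 by reflexivity.
      lra. }
    generalize (Cmod_ge_0 v); intros v0.
    destruct (Rle_lt_or_eq_dec _ _ v0) as [vp | vz].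
    + apply Rmult_le_reg_r with (Cmod v); [exact vp|].
      rewrite eq'; eapply Rle_trans; [exact cs|].
      apply Rmult_le_compat_r; assumption.
    + rewrite <- vz; eapply Rle_trans; [apply Cmod_ge_0 | exact bound].
Qed.

Lemma Cmod_scale_le (t : R) (z : C) :
  (0 <= t <= 1)%R -> (Cmod (RtoC t * z) <= Cmod z)%R.
Proof.
  intros ht; rewrite Cmod_mult, Cmod_R, Rabs_pos_eq by tauto.
  generalize (Cmod_ge_0 z); nra.
Qed.

Lemma Cexp_bound_scale (t : R) (z : C) :
  (0 <= t <= 1)%R -> (Cmod (Cexp (RtoC t * z)) <= exp (Cmod z))%R.
Proof.
  intros ht; eapply Rle_trans; [apply Cmod_Cexp_le|].
  apply exp_mono, Cmod_scale_le, ht.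
Qed.

Lemma Cexp_taylor0 (z : C) : (Cmod (Cexp z - 1) <= Cmod z * exp (Cmod z))%R.
Proof.
  generalize (mean_value_ineq (fun t => Cexp (RtoC t * z))
     (fun t => z * Cexp (RtoC t * z)) (Cmod z * exp (Cmod z))).
  rewrite Cmult_1_l, Cmult_0_l, Cexp_0; intros mv; apply mv; clear mv.
  - destruct z as [a b]; intros t; unfold Cexp; simpl.
    auto_derive; [trivial|].
    rewrite ?Rmult_0_l, ?Ropp_0, ?Rminus_0_r, ?Rplus_0_r.
    ring.
  - destruct z as [a b]; intros t; unfold Cexp; simpl.
    auto_derive; [trivial|].
    rewrite ?Rmult_0_l, ?Ropp_0, ?Rminus_0_r, ?Rplus_0_r.
    ring.
  - intros t ht; rewrite Cmod_mult.
    apply Rmult_le_compat_l; [apply Cmod_ge_0 | apply Cexp_bound_scale, ht].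
Qed.

(** Each further Taylor remainder is the integral of the preceding one along the
    segment from [0] to [z]. *)
Lemma Cexp_taylor1 (z : C) :
  (Cmod (Cexp z - 1 - z) <= Cmod z ^ 2 * exp (Cmod z))%R.
Proof.
  generalize (mean_value_ineq (fun t => Cexp (RtoC t * z) - RtoC t * z)
     (fun t => z * (Cexp (RtoC t * z) - 1)) (Cmod z ^ 2 * exp (Cmod z))).
  rewrite Cmult_1_l, Cmult_0_l, Cexp_0.
  replace (Cexp z - z - (1 - 0)) with (Cexp z - 1 - z) by ring.
  intros mv; apply mv; clear mv.
  - destruct z as [a b]; intros t; unfold Cexp; simpl.
    auto_derive; [trivial|].
    rewrite ?Rmult_0_l, ?Ropp_0, ?Rminus_0_r, ?Rplus_0_r.
    ring.
  - destruct z as [a b]; intros t; unfold Cexp; simpl.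
    auto_derive; [trivial|].
    rewrite ?Rmult_0_l, ?Ropp_0, ?Rminus_0_r, ?Rplus_0_r.
    ring.
  - intros t ht; rewrite Cmod_mult.
    replace (Cmod z ^ 2 * exp (Cmod z))%R
      with (Cmod z * (Cmod z * exp (Cmod z)))%R by ring.
    apply Rmult_le_compat_l; [apply Cmod_ge_0|].
    eapply Rle_trans; [apply Cexp_taylor0|].
    apply Rmult_le_compat;
      [apply Cmod_ge_0 | left; apply exp_pos | | apply exp_mono];
      apply Cmod_scale_le, ht.
Qed.

Lemma Cexp_taylor2 (z : C) :
  (Cmod (Cexp z - 1 - z - z * z / 2) <= Cmod z ^ 3 * exp (Cmod z))%R.
Proof.
  generalize (mean_value_ineq
     (fun t => Cexp (RtoC t * z) - RtoC t * z - RtoC (t * t / 2) * (z * z))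
     (fun t => z * (Cexp (RtoC t * z) - 1 - RtoC t * z))
     (Cmod z ^ 3 * exp (Cmod z))).
  rewrite Cmult_1_l, Cmult_0_l, Cexp_0.
  replace (_ - _ - _ - _) with (Cexp z - 1 - z - z * z / 2).
  2:{ rewrite !RtoC_div, !RtoC_mult by lra; field; apply RtoC_inj; lra. }
  intros mv; apply mv; clear mv.
  - destruct z as [a b]; intros t; unfold Cexp; simpl.
    auto_derive; [trivial|].
    rewrite ?Rmult_0_l, ?Ropp_0, ?Rminus_0_r, ?Rplus_0_r.
    field.
  - destruct z as [a b]; intros t; unfold Cexp; simpl.
    auto_derive; [trivial|].
    rewrite ?Rmult_0_l, ?Ropp_0, ?Rminus_0_r, ?Rplus_0_r.
    field.
  - intros t ht; rewrite Cmod_mult.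
    replace (Cmod z ^ 3 * exp (Cmod z))%R
      with (Cmod z * (Cmod z ^ 2 * exp (Cmod z)))%R by ring.
    apply Rmult_le_compat_l; [apply Cmod_ge_0|].
    eapply Rle_trans; [apply Cexp_taylor1|].
    apply Rmult_le_compat;
      [apply pow_le, Cmod_ge_0 | left; apply exp_pos | | apply exp_mono];
      [apply pow_incr; split; [apply Cmod_ge_0|]|];
      apply Cmod_scale_le, ht.
Qed.

(** * Infinite products *)

(** Convergence of complex sequences, taken coordinatewise so that the limit
    theory of real sequences applies directly. *)
Definition is_Clim (u : nat -> C) (l : C) : Prop :=
  is_lim_seq (fun n => Re (u n)) (Re l) /\ is_lim_seq (fun n => Im (u n)) (Im l).

Lemma is_Clim_filterlim (u : nat -> C) (l : C) :
  is_Clim u l ->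
  filterlim u eventually (locally (l : C_CompleteNormedModule)).
Proof.
  intros [hr hi].
  apply filterlim_locally; intros eps.
  apply (proj1 (filterlim_locally _ _)) with (eps := eps) in hr.
  apply (proj1 (filterlim_locally _ _)) with (eps := eps) in hi.
  exact (filter_and _ _ hr hi).
Qed.

Lemma Cinfprod_eq (f : nat -> C) (l : C) :
  is_Clim (Cprod f) l -> Cinfprod f = l.
Proof.
  intros h; unfold Cinfprod.
  apply (iota_filterlim_locally (V := C_CompleteNormedModule)
           (F := eventually)).
  now apply is_Clim_filterlim.
Qed.

Lemma is_Clim_const (c : C) : is_Clim (fun _ => c) c.
Proof. split; apply is_lim_seq_const. Qed.

Lemma is_Clim_mult (u v : nat -> C) (a b : C) :
  is_Clim u a -> is_Clim v b -> is_Clim (fun n => u n * v n) (a * b).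
Proof.
  intros [ur ui] [vr vi]; split; simpl.
  - apply is_lim_seq_minus'; now apply is_lim_seq_mult'.
  - apply is_lim_seq_plus'; now apply is_lim_seq_mult'.
Qed.

Lemma is_Clim_unique (u : nat -> C) (a b : C) :
  is_Clim u a -> is_Clim u b -> a = b.
Proof.
  intros [ur ui] [vr vi].
  apply is_lim_seq_unique in ur, ui, vr, vi.
  apply injective_projections; apply Rbar_finite_eq.
  - exact (eq_trans (eq_sym ur) vr).
  - exact (eq_trans (eq_sym ui) vi).
Qed.

Lemma is_Clim_ext (u v : nat -> C) (l : C) :
  (forall n, u n = v n) -> is_Clim u l -> is_Clim v l.
Proof.
  intros e [hr hi]; split.
  - apply is_lim_seq_ext with (2 := hr); intros n; now rewrite e.
  - apply is_lim_seq_ext with (2 := hi); intros n; now rewrite e.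
Qed.

Lemma is_Clim_incr_1 (u : nat -> C) (l : C) :
  is_Clim u l -> is_Clim (fun n => u (S n)) l.
Proof.
  intros [hr hi]; split.
  - now apply (is_lim_seq_incr_1 (fun n => Re (u n))).
  - now apply (is_lim_seq_incr_1 (fun n => Im (u n))).
Qed.

Lemma is_Clim_Cmod (u : nat -> C) (l : C) :
  is_Clim u l -> is_lim_seq (fun n => Cmod (u n)) (Cmod l).
Proof.
  intros [hr hi]; unfold Cmod.
  apply (is_lim_seq_continuous sqrt (fun n => fst (u n) ^ 2 + snd (u n) ^ 2)%R
           (fst l ^ 2 + snd l ^ 2)%R).
  - apply continuity_pt_sqrt; nra.
  - simpl; apply is_lim_seq_plus'; repeat apply is_lim_seq_mult';
      try assumption; apply is_lim_seq_const.
Qed.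

(** Summability of [|f k - 1|] is expressed by a majorant [B] of its partial
    sums: in every application such a [B] is known in closed form, and all
    bounds come out in terms of [B]. *)
Definition dominated (f : nat -> C) (B : nat -> R) : Prop :=
  forall k, (Cmod (f k - 1) <= B (S k) - B k)%R.

Lemma dominated_incr (f : nat -> C) (B : nat -> R) (n p : nat) :
  dominated f B -> (B n <= B (n + p)%nat)%R.
Proof.
  intros hB; induction p as [|p IH]; [rewrite Nat.add_0_r; lra|].
  rewrite Nat.add_succ_r.
  generalize (hB (n + p)%nat) (Cmod_ge_0 (f (n + p)%nat - 1)); lra.
Qed.

Lemma Cprod_le (f : nat -> C) (B : nat -> R) (n : nat) :
  dominated f B -> (Cmod (Cprod f n) <= exp (B n - B O))%R.
Proof.
  intros hB; induction n as [|n IH]; simpl.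
  { rewrite Cmod_1, Rminus_diag, exp_0; lra. }
  rewrite Cmod_mult.
  replace (B (S n) - B O)%R with ((B n - B O) + (B (S n) - B n))%R by ring.
  rewrite exp_plus.
  apply Rmult_le_compat; try apply Cmod_ge_0; [exact IH|].
  replace (f n) with (1 + (f n - 1)) by ring.
  eapply Rle_trans; [apply Cmod_triangle|]; rewrite Cmod_1.
  generalize (hB n) (exp_ineq1_le (B (S n) - B n)); lra.
Qed.

(** Lower bound for the partial products, which survives in the limit: with all
    factors bounded below by [c], one has 1 / |f k| <= 1 + |f k - 1| / c. *)
Lemma Cprod_ge (f : nat -> C) (B : nat -> R) (c : R) (n : nat) :
  dominated f B -> (0 < c)%R -> (forall k, (c <= Cmod (f k))%R) ->
  (exp (- ((B n - B O) / c)) <= Cmod (Cprod f n))%R.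
Proof.
  intros hB c0 hc; induction n as [|n IH]; simpl.
  { rewrite Cmod_1, Rminus_diag; unfold Rdiv.
    rewrite Rmult_0_l, Ropp_0, exp_0; lra. }
  rewrite Cmod_mult.
  replace (- ((B (S n) - B O) / c))%R
    with (- ((B n - B O) / c) + - ((B (S n) - B n) / c))%R by (field; lra).
  rewrite exp_plus.
  apply Rmult_le_compat; try (left; apply exp_pos); [exact IH|].
  rewrite exp_Ropp.
  generalize (hc n) (hB n) (exp_ineq1_le ((B (S n) - B n) / c)).
  intros h1 h2 h3.
  assert (tri : (1 <= Cmod (f n) + Cmod (f n - 1))%R).
  { generalize (Cmod_sub_le (f n) (f n - 1)).
    replace (f n - (f n - 1)) with (RtoC 1) by ring.
    now rewrite Cmod_1. }
  set (e := exp ((B (S n) - B n) / c)%R) in *.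
  assert (e0 : (0 < e)%R) by apply exp_pos.
  assert (d0 : (B (S n) - B n = c * ((B (S n) - B n) / c))%R) by (field; lra).
  set (d := ((B (S n) - B n) / c)%R) in *.
  generalize (Cmod_ge_0 (f n - 1)); intros m0.
  assert (dp : (0 <= d)%R) by nra.
  apply Rmult_le_reg_r with e; [exact e0|].
  rewrite Rinv_l by lra.
  nra.
Qed.

Lemma Cprod_sub_1_le (f : nat -> C) (B : nat -> R) (n : nat) :
  dominated f B -> (Cmod (Cprod f n - 1) <= exp (B n - B O) - 1)%R.
Proof.
  intros hB; induction n as [|n IH]; simpl.
  { rewrite Rminus_diag, exp_0.
    replace (1 - 1) with (RtoC 0) by ring; rewrite Cmod_0; lra. }
  replace (Cprod f n * f n - 1)
    with (Cprod f n * (f n - 1) + (Cprod f n - 1)) by ring.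
  eapply Rle_trans; [apply Cmod_triangle|]; rewrite Cmod_mult.
  replace (B (S n) - B O)%R with ((B n - B O) + (B (S n) - B n))%R by ring.
  rewrite exp_plus.
  generalize (Cprod_le f B n hB) (hB n) (exp_ineq1_le (B (S n) - B n))
    (Cmod_ge_0 (f n - 1)) (exp_pos (B n - B O)) (Cmod_ge_0 (Cprod f n)).
  intros h1 h2 h3 h4 h5 h6.
  assert (h7 : (Cmod (Cprod f n) * Cmod (f n - 1)
                <= exp (B n - B O) * (B (S n) - B n))%R)
    by (apply Rmult_le_compat; assumption).
  nra.
Qed.

Lemma Cprod_cauchy (f : nat -> C) (B : nat -> R) (beta : R) (n p : nat) :
  dominated f B -> (forall k, (B k <= beta)%R) ->
  (Cmod (Cprod f (n + p) - Cprod f n)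
     <= exp (beta - B O) * (B (n + p)%nat - B n))%R.
Proof.
  intros hB hb; induction p as [|p IH].
  { rewrite Nat.add_0_r, !Rminus_diag.
    replace (_ - _) with (RtoC 0) by ring; rewrite Cmod_0; lra. }
  rewrite Nat.add_succ_r; simpl.
  replace (_ - _)
    with ((Cprod f (n + p) - Cprod f n)
          + Cprod f (n + p) * (f (n + p)%nat - 1)) by ring.
  eapply Rle_trans; [apply Cmod_triangle|]; rewrite Cmod_mult.
  assert (h : (Cmod (Cprod f (n + p)) * Cmod (f (n + p)%nat - 1)
     <= exp (beta - B O) * (B (S (n + p)) - B (n + p)%nat))%R).
  { apply Rmult_le_compat; try apply Cmod_ge_0; [|apply hB].
    eapply Rle_trans; [apply Cprod_le, hB|].
    apply exp_mono; generalize (hb (n + p)%nat); lra. }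
  lra.
Qed.

Lemma Cprod_converges (f : nat -> C) (B : nat -> R) (beta : R) :
  dominated f B -> (forall k, (B k <= beta)%R) ->
  exists l, is_Clim (Cprod f) l.
Proof.
  intros hB hb.
  assert (cB : ex_lim_seq_cauchy B).
  { apply ex_lim_seq_cauchy_corr, ex_finite_lim_seq_incr with beta;
      [|exact hb].
    intros n; generalize (dominated_incr f B n 1 hB).
    now rewrite Nat.add_1_r. }
  assert (part : forall g : C -> R,
    (forall a b, (Rabs (g a - g b) <= Cmod (a - b))%R) ->
    ex_finite_lim_seq (fun n => g (Cprod f n))).
  { intros g hg; apply ex_lim_seq_cauchy_corr; intros eps.
    assert (e0 : (0 < eps / exp (beta - B O))%R)
      by (apply Rdiv_lt_0_compat; [apply cond_pos | apply exp_pos]).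
    destruct (cB (mkposreal _ e0)) as [N hN]; simpl in hN.
    assert (wlog : forall n p, (N <= n)%nat ->
       (Rabs (g (Cprod f (n + p)) - g (Cprod f n)) < eps)%R).
    { intros n p hn.
      eapply Rle_lt_trans; [apply hg|].
      eapply Rle_lt_trans; [apply (Cprod_cauchy f B beta n p hB hb)|].
      assert (h := hN (n + p)%nat n ltac:(lia) hn).
      apply Rabs_def2 in h; destruct h as [h _].
      apply Rmult_lt_compat_l with (r := exp (beta - B O)) in h;
        [|apply exp_pos].
      replace (pos eps) with
        (exp (beta - B O) * (eps / exp (beta - B O)))%R; [exact h|].
      field; apply Rgt_not_eq, exp_pos. }
    exists N; intros n m hn hm.
    destruct (Nat.le_ge_cases n m) as [le | le].
    - rewrite Rabs_minus_sym; replace m with (n + (m - n))%nat by lia.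
      now apply wlog.
    - replace n with (m + (n - m))%nat by lia; now apply wlog. }
  destruct (part Re) as [a ha].
  { intros x y; replace (Re x - Re y)%R with (Re (x - y)) by reflexivity.
    apply re_le_Cmod. }
  destruct (part Im) as [b hb'].
  { intros x y; replace (Im x - Im y)%R with (Im (x - y)) by reflexivity.
    eapply Rle_trans; [|apply Rmax_Cmod]; apply Rmax_r. }
  exists (a, b); split; assumption.
Qed.

Lemma Cprod_lim_neq_0 (f : nat -> C) (B : nat -> R) (beta c : R) (l : C) :
  dominated f B -> (forall k, (B k <= beta)%R) ->
  (0 < c)%R -> (forall k, (c <= Cmod (f k))%R) ->
  is_Clim (Cprod f) l -> l <> 0.
Proof.
  intros hB hb c0 hc hl.
  apply Cmod_gt_0, Rlt_le_trans with (exp (- ((beta - B O) / c)));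
    [apply exp_pos|].
  assert (le := is_lim_seq_le (fun _ => exp (- ((beta - B O) / c)))
    (fun n => Cmod (Cprod f n)) (exp (- ((beta - B O) / c))) (Cmod l)).
  apply le; [|apply is_lim_seq_const | now apply is_Clim_Cmod].
  intros n; eapply Rle_trans; [|apply (Cprod_ge f B c n hB c0 hc)].
  apply exp_mono, Ropp_le_contravar, Rmult_le_compat_r;
    [left; now apply Rinv_0_lt_compat|].
  generalize (hb n); lra.
Qed.

Lemma Cprod_lim_sub_1_le (f : nat -> C) (B : nat -> R) (beta : R) (l : C) :
  dominated f B -> (forall k, (B k <= beta)%R) ->
  is_Clim (Cprod f) l -> (Cmod (l - 1) <= exp (beta - B O) - 1)%R.
Proof.
  intros hB hb [hr hi].
  assert (hl1 : is_Clim (fun n => Cprod f n - 1) (l - 1)).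
  { split; apply is_lim_seq_minus'; try assumption; apply is_lim_seq_const. }
  assert (le := is_lim_seq_le (fun n => Cmod (Cprod f n - 1))
    (fun _ => (exp (beta - B O) - 1)%R) (Cmod (l - 1)) (exp (beta - B O) - 1)%R).
  apply le; [|now apply is_Clim_Cmod | apply is_lim_seq_const].
  intros n; eapply Rle_trans; [apply (Cprod_sub_1_le f B n hB)|].
  apply Rplus_le_compat_r, exp_mono; generalize (hb n); lra.
Qed.

(** * Shifting the argument of the factor (1 - exp (- x)) / x *)

Definition bose (x : R) : R := (/ (exp x - 1))%R.

Lemma expm1_pos (x : R) : (0 < x)%R -> (0 < exp x - 1)%R.
Proof. intros hx; generalize (exp_ineq1 x); lra. Qed.

Lemma expm1_ge_cubic (x : R) :
  (0 < x)%R -> (x + x ^ 2 / 2 + x ^ 3 / 6 <= exp x - 1)%R.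
Proof.
  intros hx; generalize (exp_ge_taylor x 3 (Rlt_le _ _ hx)).
  simpl; lra.
Qed.

Lemma expm1_sub_le (x : R) :
  (0 < x)%R -> (exp x - 1 - x <= x * (exp x - 1))%R.
Proof.
  intros hx.
  (* this is [exp (- x) >= 1 - x] multiplied by [exp x] *)
  generalize (exp_ineq1_le (- x)) (exp_pos x); rewrite exp_Ropp; intros h e0.
  apply Rmult_le_compat_l with (r := exp x) in h; [|lra].
  rewrite Rinv_r in h; lra.
Qed.

(** Near [0] the left side is of order [x ^ 3], as is the right side; beyond [1]
    the factor [x ^ 2] makes the inequality trivial. *)
Lemma expm1_sub_quadratic_le (x : R) :
  (0 < x)%R -> (exp x - 1 - x - x ^ 2 / 2 <= 3 * (x ^ 2 * (exp x - 1)))%R.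
Proof.
  intros hx.
  generalize (expm1_ge_cubic x hx); intros hc.
  destruct (Rle_dec x 1) as [h1 | h1].
  - generalize (Cexp_taylor2 (RtoC x)).
    replace (Cexp x - 1 - x - x * x / 2)
      with (RtoC (exp x - 1 - x - x ^ 2 / 2)).
    2:{ rewrite Cexp_RtoC; apply injective_projections; simpl; field. }
    rewrite !Cmod_R, (Rabs_pos_eq x) by lra.
    intros h; apply Rle_trans with (1 := Rle_abs _).
    apply Rle_trans with (1 := h).
    assert (exp x <= 3)%R
      by (apply Rle_trans with (2 := exp_le_3), exp_mono, h1).
    apply Rle_trans with (x ^ 3 * 3)%R.
    + apply Rmult_le_compat_l; [apply pow_le; lra | assumption].
    + replace (x ^ 3 * 3)%R with (3 * (x ^ 2 * x))%R by ring.
      assert (0 <= x ^ 2)%R by nra.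
      assert (x <= exp x - 1)%R by nra.
      nra.
  - assert (1 <= x ^ 2)%R by nra.
    assert (0 < exp x - 1)%R by nra.
    assert (exp x - 1 <= x ^ 2 * (exp x - 1))%R by nra.
    lra.
Qed.

Lemma le_div_pow2 (a b x : R) (n : nat) :
  (0 <= x)%R -> (a * (1 + x) ^ n <= b)%R -> (a <= b / (1 + x) ^ n)%R.
Proof.
  intros hx h.
  assert (p : (0 < (1 + x) ^ n)%R) by (apply pow_lt; lra).
  apply Rmult_le_reg_r with (1 := p).
  unfold Rdiv; rewrite Rmult_assoc, Rinv_l; lra.
Qed.

Lemma mul_bose_le (x : R) : (0 < x)%R -> (x * bose x <= 6 / (1 + x) ^ 2)%R.
Proof.
  intros hx; apply le_div_pow2; [lra|]; unfold bose.
  generalize (expm1_ge_cubic x hx) (expm1_pos x hx); intros h p.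
  apply Rmult_le_reg_r with (1 := p).
  replace (x * / (exp x - 1) * (1 + x) ^ 2 * (exp x - 1))%R
    with (x * (1 + x) ^ 2)%R by (field; lra).
  nra.
Qed.

(** [bose x - / x] is the logarithmic derivative of (1 - exp (- x)) / x; the
    poles at [0] cancel. *)
Lemma bose_sub_inv_bound (x : R) :
  (0 < x)%R -> (Rabs (bose x - / x) <= 2 / (1 + x))%R.
Proof.
  intros hx.
  generalize (expm1_ge_cubic x hx) (expm1_pos x hx) (expm1_sub_le x hx).
  unfold bose; set (D := (exp x - 1)%R); intros h p q.
  replace (/ D - / x)%R with (- ((D - x) / (x * D)))%R by (field; lra).
  rewrite Rabs_Ropp.
  assert (xD : (0 < x * D)%R) by nra.
  assert (0 <= D - x)%R by nra.
  rewrite Rabs_pos_eq by (apply Rdiv_le_0_compat; lra).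
  rewrite <- (pow_1 (1 + x)); apply le_div_pow2; [lra|].
  apply Rmult_le_reg_r with (1 := xD).
  replace (_ * _)%R with ((D - x) * (1 + x))%R by (simpl; field; lra).
  nra.
Qed.

(** With F x = (1 - exp (- x)) / x and g x = bose x - 1 / x, this combination is
    minus the coefficient of [d ^ 2] in (F (x + d) / F x - 1 - d g x) (1 + d / x).
    The poles of order 2 and 1 at [0] cancel, and every term decays at least like
    [x ^ (-2)] at infinity. *)
Lemma bose_curvature_bound (x : R) :
  (0 < x)%R ->
  (Rabs (bose x / 2 + bose x / x - / (x ^ 2)) <= 10 / (1 + x) ^ 2)%R.
Proof.
  intros hx.
  generalize (expm1_ge_cubic x hx) (expm1_pos x hx) (expm1_sub_le x hx)
    (expm1_sub_quadratic_le x hx).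
  unfold bose; set (D := (exp x - 1)%R); intros h p q r.
  set (T := (D - x - x ^ 2 / 2)%R) in *.
  assert (x3 : (0 < x ^ 3)%R) by (apply pow_lt; exact hx).
  assert (xD : (0 < x ^ 2 * D)%R)
    by (apply Rmult_lt_0_compat; [apply pow_lt|]; assumption).
  replace (/ D / 2 + / D / x - / x ^ 2)%R with (- (T / (x ^ 2 * D)))%R
    by (unfold T; field; lra).
  assert (T0 : (0 <= T)%R) by (unfold T; lra).
  rewrite Rabs_Ropp, Rabs_pos_eq by (apply Rdiv_le_0_compat; lra).
  apply le_div_pow2; [lra|].
  apply Rmult_le_reg_r with (1 := xD).
  replace (_ * _)%R with (T + 2 * (x * T) + x ^ 2 * T)%R by (field; lra).
  assert (x2 : (0 < x ^ 2)%R) by (apply pow_lt; exact hx).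
  assert (TD : (T <= D)%R) by (unfold T; lra).
  assert (TxD : (T <= x * D)%R) by (unfold T; lra).
  assert (x * T <= x * (x * D))%R by (apply Rmult_le_compat_l; lra).
  assert (x ^ 2 * T <= x ^ 2 * D)%R by (apply Rmult_le_compat_l; lra).
  lra.
Qed.

Lemma Cexp_neg_taylor2_small (d : C) : (Cmod d <= 1)%R ->
  (Cmod (Cexp (- d) - 1 + d - d * d / 2) <= 3 * Cmod d ^ 3)%R.
Proof.
  intros hd; generalize (Cexp_taylor2 (- d)); rewrite Cmod_opp.
  replace (Cexp (- d) - 1 - - d - - d * - d / 2)
    with (Cexp (- d) - 1 + d - d * d / 2)
    by (field; apply RtoC_inj; lra).
  intros h; apply Rle_trans with (1 := h); rewrite Rmult_comm.
  apply Rmult_le_compat_r; [apply pow_le, Cmod_ge_0|].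
  apply Rle_trans with (2 := exp_le_3), exp_mono, hd.
Qed.

(** With F x = (1 - exp (- x)) / x, this is F (x + d) / F x. *)
Definition shift_ratio (x : R) (d : C) : C :=
  (1 + (1 - Cexp (- d)) * RtoC (bose x)) / (1 + d / RtoC x).

(** A Taylor estimate of second order whose error decays in [x]: the coefficient
    of [d ^ 2] is controlled by [bose_curvature_bound], and in the third order
    term, which carries the unbounded factor [bose x], one power of [d] is traded
    for [m * x]. *)
Lemma shift_ratio_bound (x c m : R) (d : C) :
  (0 < x)%R -> (0 < c)%R -> (0 <= m)%R ->
  (Cmod d <= 1)%R -> (Cmod d <= m * x)%R ->
  (c <= Cmod (1 + d / RtoC x))%R ->
  (Cmod (shift_ratio x d - 1 - d * RtoC (bose x - / x))
     <= (10 + 18 * m) / c * (Cmod d ^ 2 / (1 + x) ^ 2))%R.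
Proof.
  intros hx hc hm d1 dmx hden.
  assert (den : 1 + d / RtoC x <> 0) by (apply Cmod_gt_0; lra).
  assert (x0 : RtoC x <> 0) by (intros e; apply RtoC_inj in e; lra).
  set (P := Cexp (- d) - 1 + d - d * d / 2).
  assert (hP : (Cmod P <= 3 * Cmod d ^ 3)%R)
    by (apply Cexp_neg_taylor2_small, d1).
  set (k := (bose x / 2 + bose x / x - / (x ^ 2))%R).
  assert (hk : (Rabs k <= 10 / (1 + x) ^ 2)%R)
    by (apply bose_curvature_bound, hx).
  assert (hu := mul_bose_le x hx).
  assert (u0 : (0 < bose x)%R)
    by (apply Rinv_0_lt_compat, expm1_pos, hx).
  assert (id : (shift_ratio x d - 1 - d * RtoC (bose x - / x)) * (1 + d / RtoC x)
     = - (d * d * RtoC k + P * RtoC (bose x))).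
  { unfold shift_ratio, k, P.
    rewrite !RtoC_minus, !RtoC_plus, !RtoC_div, !RtoC_inv, RtoC_pow
      by (try apply pow_nonzero; lra).
    field; repeat split; try exact x0; try (intros e; apply RtoC_inj in e; lra).
    intros e; apply den.
    replace (1 + d / RtoC x) with ((RtoC x + d) / RtoC x) by (field; exact x0).
    rewrite e; field; exact x0. }
  apply Rmult_le_reg_r with c; [exact hc|].
  apply Rle_trans with (1 := Rmult_le_compat_l _ _ _ (Cmod_ge_0 _) hden).
  rewrite <- Cmod_mult, id, Cmod_opp.
  eapply Rle_trans; [apply Cmod_triangle|].
  rewrite !Cmod_mult, !Cmod_R, (Rabs_pos_eq (bose x)) by lra.
  replace (_ * c)%R
    with (Cmod d ^ 2 * (10 / (1 + x) ^ 2)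
          + 3 * Cmod d ^ 2 * (m * (6 / (1 + x) ^ 2)))%R
    by (field; split; lra).
  generalize (Cmod_ge_0 d); intros dp.
  apply Rplus_le_compat.
  - simpl; rewrite Rmult_1_r.
    apply Rmult_le_compat_l; [nra | exact hk].
  - apply Rle_trans with (3 * Cmod d ^ 3 * bose x)%R.
    + apply Rmult_le_compat_r; lra.
    + replace (3 * Cmod d ^ 3 * bose x)%R
        with (3 * Cmod d ^ 2 * (Cmod d * bose x))%R by ring.
      apply Rmult_le_compat_l; [nra|].
      apply Rle_trans with (m * (x * bose x))%R; [nra|].
      apply Rmult_le_compat_l; assumption.
Qed.

(** * Factors of the form (1 + w y) (1 + y) ^ (- w) *)

Lemma ln_1p_sub_bound (y : R) :
  (- / 2 <= y)%R -> (Rabs (ln (1 + y) - y) <= 2 * y ^ 2)%R.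
Proof.
  intros hy.
  assert (up : (ln (1 + y) <= y)%R).
  { rewrite <- (ln_exp y) at 2.
    apply ln_le; [lra | apply exp_ineq1_le]. }
  assert (lo : (ln (/ (1 + y)) <= / (1 + y) - 1)%R).
  { rewrite <- (ln_exp (/ (1 + y) - 1)) at 1.
    apply ln_le; [apply Rinv_0_lt_compat; lra|].
    generalize (exp_ineq1_le (/ (1 + y) - 1)); lra. }
  rewrite ln_Rinv in lo by lra.
  assert (y2 : (/ (1 + y) - 1 <= - y + 2 * y ^ 2)%R).
  { apply Rmult_le_reg_r with (1 + y)%R; [lra|].
    rewrite Rmult_minus_distr_r, Rinv_l by lra.
    assert (0 <= y ^ 2 * (1 + 2 * y))%R by (apply Rmult_le_pos; nra).
    nra. }
  apply Rabs_le_between; nra.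
Qed.

(** The first order terms of [1 + w y] and [(1 + y) ^ (- w)] cancel, and the
    perturbations [e] and [e'] count as second order. *)
Lemma cancel_first_order (w : C) (B : R) : (0 <= B)%R ->
  exists K : R, (0 <= K)%R /\ forall (y e' eta : R) (e : C),
    (y ^ 2 <= eta)%R -> (Cmod e <= B * eta)%R -> (Rabs e' <= B * eta)%R ->
    (- / 4 <= y <= 1)%R -> (Rabs e' <= / 4)%R ->
    (Cmod ((1 + w * RtoC y + e) * Cexp (- w * RtoC (ln (1 + (y + e')))) - 1)
       <= K * eta)%R.
Proof.
  intros hB.
  set (W := Cmod w); assert (W0 : (0 <= W)%R) by apply Cmod_ge_0.
  assert (E0 := exp_pos (5 * W)).
  (* [E3], [E4]: coefficients of the errors in [- w ln (1 + y + e')] and in the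
     linearisation of the exponential *)
  set (Q := (2 + B)%R).
  set (E3 := (W * (B + 2 * Q))%R).
  set (E4 := (16 * W ^ 2 * Q * exp (5 * W))%R).
  assert (Q0 : (0 <= Q)%R) by (unfold Q; lra).
  assert (E30 : (0 <= E3)%R) by (unfold E3; apply Rmult_le_pos; lra).
  assert (E40 : (0 <= E4)%R).
  { unfold E4; repeat apply Rmult_le_pos; simpl; nra. }
  exists (W ^ 2 + (1 + W) * (E3 + E4) + B * exp (5 * W))%R; split.
  { apply Rplus_le_le_0_compat; [apply Rplus_le_le_0_compat|];
      repeat apply Rmult_le_pos; simpl; nra. }
  intros y e' eta e hy he he' y4 e4.
  set (y1 := (y + e')%R).
  assert (eta0 : (0 <= eta)%R) by (generalize (pow2_ge_0 y); lra).
  apply Rabs_le_between in e4 as e4'.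
  assert (y1lo : (- / 2 <= y1)%R) by (unfold y1; lra).
  assert (yabs : (Rabs y <= 1)%R) by (apply Rabs_le_between; lra).
  assert (y1h : (Rabs y1 <= 5 / 4)%R)
    by (apply Rabs_le_between; unfold y1; lra).
  assert (y1sq : (y1 ^ 2 <= Q * eta)%R).
  { assert (e' ^ 2 <= / 4 * (B * eta))%R.
    { rewrite <- (pow2_abs e'); generalize (Rabs_pos e'); nra. }
    unfold y1, Q; generalize (pow2_ge_0 (y - e')); nra. }
  assert (hln := ln_1p_sub_bound y1 y1lo).
  assert (y1abs : (Rabs y1 ^ 2 <= 5 / 4 * Rabs y1)%R)
    by (generalize (Rabs_pos y1); nra).
  assert (hln2 : (Rabs (ln (1 + y1)) <= 4 * Rabs y1)%R).
  { replace (ln (1 + y1)) with ((ln (1 + y1) - y1) + y1)%R by ring.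
    eapply Rle_trans; [apply Rabs_triang|].
    rewrite <- (pow2_abs y1) in hln; generalize (Rabs_pos y1); lra. }
  set (z := - w * RtoC (ln (1 + y1))).
  assert (hz : (Cmod z <= 4 * W * Rabs y1)%R).
  { unfold z; rewrite Cmod_mult, Cmod_opp, Cmod_R; fold W; nra. }
  assert (hzW : (Cmod z <= 5 * W)%R) by nra.
  set (e3 := z + w * RtoC y).
  assert (he3 : (Cmod e3 <= E3 * eta)%R).
  { unfold e3, z.
    replace (_ + _) with (- w * RtoC ((ln (1 + y1) - y1) + e')).
    2:{ unfold y1 at 2; rewrite RtoC_plus, RtoC_minus, RtoC_plus; ring. }
    rewrite Cmod_mult, Cmod_opp, Cmod_R; fold W.
    unfold E3; rewrite Rmult_assoc; apply Rmult_le_compat_l; [exact W0|].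
    eapply Rle_trans; [apply Rabs_triang|]; nra. }
  set (e5 := Cexp z - 1 - z).
  assert (he5 : (Cmod e5 <= E4 * eta)%R).
  { eapply Rle_trans; [apply Cexp_taylor1|].
    assert (z2 : (Cmod z ^ 2 <= 16 * W ^ 2 * (Q * eta))%R).
    { apply Rle_trans with ((4 * W * Rabs y1) ^ 2)%R.
      - apply pow_incr; split; [apply Cmod_ge_0 | exact hz].
      - replace ((4 * W * Rabs y1) ^ 2)%R with (16 * W ^ 2 * Rabs y1 ^ 2)%R
          by ring.
        rewrite pow2_abs; apply Rmult_le_compat_l; [nra | exact y1sq]. }
    replace (E4 * eta)%R with (16 * W ^ 2 * (Q * eta) * exp (5 * W))%R
      by (unfold E4; ring).
    apply Rmult_le_compat;
      [apply pow_le, Cmod_ge_0 | left; apply exp_pos | exact z2 |].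
    apply exp_mono, hzW. }
  assert (hexp : (Cmod (Cexp z) <= exp (5 * W))%R)
    by (eapply Rle_trans; [apply Cmod_Cexp_le | apply exp_mono, hzW]).
  assert (hwy : (Cmod (1 + w * RtoC y) <= 1 + W)%R).
  { eapply Rle_trans; [apply Cmod_triangle|].
    rewrite Cmod_1, Cmod_mult, Cmod_R; fold W.
    generalize (Rabs_pos y); nra. }
  replace (_ - 1)
    with (- (w * w * RtoC (y ^ 2)) + (1 + w * RtoC y) * (e3 + e5)
          + e * Cexp z).
  2:{ unfold e5, e3; rewrite RtoC_pow; simpl; ring. }
  eapply Rle_trans; [apply Cmod_triangle|].
  rewrite Rmult_plus_distr_r; apply Rplus_le_compat.
  - rewrite Rmult_plus_distr_r.
    eapply Rle_trans; [apply Cmod_triangle|]; apply Rplus_le_compat.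
    + rewrite Cmod_opp, !Cmod_mult, Cmod_R, Rabs_pos_eq
        by apply pow2_ge_0.
      fold W; replace (W ^ 2)%R with (W * W)%R by ring.
      apply Rmult_le_compat_l; [nra | exact hy].
    + rewrite Cmod_mult, Rmult_assoc.
      apply Rmult_le_compat; try apply Cmod_ge_0; [exact hwy|].
      eapply Rle_trans; [apply Cmod_triangle|]; lra.
  - rewrite Cmod_mult.
    replace (B * exp (5 * W) * eta)%R with (B * eta * exp (5 * W))%R by ring.
    apply Rmult_le_compat; try apply Cmod_ge_0; assumption.
Qed.

(** * Factors of the two products *)

Definition gamma_factor (w : C) (k : nat) : C :=
  (1 + w / RtoC (INR (S k))) * Rcpow (1 + / INR (S k)) (- w).

Definition Rshift_ratio (x s : R) : R :=
  ((1 + (1 - exp (- s)) * bose x) / (1 + s / x))%R.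

(** The quotient of the [k]-th factor of Euler's product for 1 / Gamma_q, with
    q = exp (- s), by the [k]-th factor of Euler's product for 1 / Gamma. *)
Definition quotient_factor (w : C) (s : R) (k : nat) : C :=
  let x := (INR (S k) * s)%R in
  shift_ratio x (w * RtoC s) * Cexp (- w * RtoC (ln (Rshift_ratio x s))).

Lemma INR_S_ge_1 (k : nat) : (1 <= INR (S k))%R.
Proof. rewrite S_INR; generalize (pos_INR k); lra. Qed.

Lemma RtoC_neq_0 (r : R) : r <> 0%R -> RtoC r <> 0.
Proof. intros h e; apply h, RtoC_inj, e. Qed.

Lemma shift_ratio_RtoC (x s : R) :
  (0 < x)%R -> (0 < s)%R -> shift_ratio x (RtoC s) = RtoC (Rshift_ratio x s).
Proof.
  intros hx hs; unfold shift_ratio, Rshift_ratio.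
  assert (0 < s / x)%R by now apply Rdiv_lt_0_compat.
  rewrite RtoC_div, !RtoC_plus, RtoC_mult, RtoC_minus, RtoC_div by lra.
  now rewrite <- RtoC_opp, Cexp_RtoC.
Qed.

(** The hypothesis on [w] enters here: no [1 + w / j] vanishes, and they tend
    to [1]. *)
Lemma one_plus_div_lower (w : C) :
  (forall n : nat, w <> RtoC (- INR n)) ->
  exists c : R, (0 < c)%R /\ forall k, (c <= Cmod (1 + w / RtoC (INR (S k))))%R.
Proof.
  intros hw.
  assert (fin : forall n, exists c : R, (0 < c)%R /\
    forall k, (k < n)%nat -> (c <= Cmod (1 + w / RtoC (INR (S k))))%R).
  { induction n as [|n [c [c0 hc]]]; [exists 1%R; split; [lra | lia]|].
    assert (j1 := INR_S_ge_1 n).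
    assert (p : (0 < Cmod (1 + w / RtoC (INR (S n))))%R).
    { apply Cmod_gt_0; intros e; apply (hw (S n)).
      rewrite RtoC_opp.
      replace w with ((1 + w / RtoC (INR (S n))) * RtoC (INR (S n))
                      - RtoC (INR (S n))).
      - rewrite e; ring.
      - field; apply RtoC_neq_0; lra. }
    exists (Rmin c (Cmod (1 + w / RtoC (INR (S n))))); split;
      [now apply Rmin_glb_lt|].
    intros k hk; destruct (Nat.eq_dec k n) as [-> | ne]; [apply Rmin_r|].
    eapply Rle_trans; [apply Rmin_l | apply hc; lia]. }
  destruct (nfloor_ex (2 * Cmod w)) as [N [_ hN]];
    [generalize (Cmod_ge_0 w); lra|].
  destruct (fin N) as [c [c0 hc]].
  exists (Rmin c (/ 2)); split; [apply Rmin_glb_lt; lra|].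
  intros k; destruct (Nat.lt_ge_cases k N) as [lt | ge].
  { eapply Rle_trans; [apply Rmin_l | now apply hc]. }
  eapply Rle_trans; [apply Rmin_r|].
  apply le_INR in ge; assert (j1 := INR_S_ge_1 k).
  assert (small : (Cmod (w / RtoC (INR (S k))) <= / 2)%R).
  { rewrite Cmod_div, Cmod_R, Rabs_pos_eq by (try apply RtoC_neq_0; lra).
    rewrite S_INR in *.
    apply Rmult_le_reg_r with (INR k + 1)%R; [lra|].
    unfold Rdiv; rewrite Rmult_assoc, Rinv_l; lra. }
  generalize (Cmod_sub_le (1 + w / RtoC (INR (S k))) (w / RtoC (INR (S k)))).
  replace (_ - _) with (RtoC 1) by ring.
  rewrite Cmod_1; lra.
Qed.

(** Here the perturbations vanish and [y] is 1 / j; the case j = 1 is the reason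
    why [cancel_first_order] admits [y] up to [1]. *)
Lemma gamma_factor_bound (w : C) :
  exists K : R, (0 <= K)%R /\
    forall k, (Cmod (gamma_factor w k - 1) <= K * (/ INR (S k)) ^ 2)%R.
Proof.
  destruct (cancel_first_order w 0 (Rle_refl 0)) as [K [K0 hK]].
  exists K; split; [exact K0|]; intros k.
  assert (j1 := INR_S_ge_1 k).
  assert (i0 : (0 < / INR (S k))%R) by (apply Rinv_0_lt_compat; lra).
  assert (i1 : (/ INR (S k) <= 1)%R)
    by (rewrite <- Rinv_1; apply Rinv_le_contravar; lra).
  generalize (hK (/ INR (S k))%R 0%R ((/ INR (S k)) ^ 2)%R 0).
  rewrite Cmod_0, Rabs_R0, Rmult_0_l, !Rplus_0_r, Cplus_0_r.
  rewrite RtoC_inv by lra.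
  intros h; apply h; try lra.
Qed.

(** [cancel_first_order] with y = s (bose x - 1 / x) at x = j s: the shift
    [w s] yields the perturbation [e], the real shift [s] the perturbation [e'].
    The constant [112] in the range of [s] makes [28 s ^ 2], which bounds [e'], at
    most [1 / 4]. *)
Lemma quotient_factor_bound (w : C) :
  (forall n : nat, w <> RtoC (- INR n)) ->
  exists K s0 : R, (0 <= K)%R /\ (0 < s0)%R /\
    forall s k, (0 < s <= s0)%R ->
      (Cmod (quotient_factor w s k - 1)
         <= K * (s ^ 2 / (1 + INR (S k) * s) ^ 2))%R.
Proof.
  intros hw.
  destruct (one_plus_div_lower w hw) as [c [c0 hc]].
  set (W := Cmod w); assert (W0 : (0 <= W)%R) by apply Cmod_ge_0.
  set (B := ((10 + 18 * W) / c * W ^ 2 + 28)%R).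
  assert (B1 : (0 <= (10 + 18 * W) / c * W ^ 2)%R).
  { apply Rmult_le_pos; [apply Rdiv_le_0_compat; lra | apply pow_le, W0]. }
  assert (B0 : (0 <= B)%R) by (unfold B; lra).
  destruct (cancel_first_order w B B0) as [K [K0 hK]].
  exists (K * 4)%R, (/ (112 * (W + 1)))%R.
  split; [lra|]; split; [apply Rinv_0_lt_compat; lra|].
  intros s k [s0 s1].
  assert (sW : (s * (112 * (W + 1)) <= 1)%R).
  { apply Rmult_le_compat_r with (r := (112 * (W + 1))%R) in s1; [|lra].
    rewrite Rinv_l in s1; lra. }
  assert (j1 := INR_S_ge_1 k).
  unfold quotient_factor; set (x := (INR (S k) * s)%R); cbv zeta.
  assert (xs : (s <= x)%R) by (unfold x; nra).
  assert (x0 : (0 < x)%R) by lra.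
  assert (div : forall a : C, a * RtoC s / RtoC x = a / RtoC (INR (S k))).
  { intros a; unfold x; rewrite RtoC_mult; field; split; apply RtoC_neq_0; lra. }
  assert (ms : Cmod (RtoC s) = s) by (rewrite Cmod_R; apply Rabs_pos_eq; lra).
  assert (mws : Cmod (w * RtoC s) = (W * s)%R)
    by (rewrite Cmod_mult, ms; reflexivity).
  set (g := (bose x - / x)%R).
  set (h := (s ^ 2 / (1 + x) ^ 2)%R).
  assert (x1 : (0 < (1 + x) ^ 2)%R) by (apply pow_lt; lra).
  assert (h0 : (0 <= h)%R)
    by (apply Rdiv_le_0_compat; [apply pow2_ge_0 | exact x1]).
  assert (hs2 : (h <= s ^ 2)%R).
  { unfold h; apply Rmult_le_reg_r with (1 := x1).
    unfold Rdiv; rewrite Rmult_assoc, Rinv_l by lra.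
    generalize (pow2_ge_0 s); nra. }
  assert (main : (Cmod (shift_ratio x (w * RtoC s) - 1
            - w * RtoC s * RtoC g) <= (10 + 18 * W) / c * W ^ 2 * h)%R).
  { eapply Rle_trans; [apply (shift_ratio_bound x c W)|]; try assumption.
    - rewrite mws; nra.
    - rewrite mws; nra.
    - rewrite div; apply hc.
    - rewrite mws; unfold h; apply Req_le; field; split; lra. }
  assert (real : (Rabs (Rshift_ratio x s - 1 - s * g) <= 28 * h)%R).
  { rewrite <- Cmod_R, !RtoC_minus, RtoC_mult, <- shift_ratio_RtoC by assumption.
    eapply Rle_trans; [apply (shift_ratio_bound x 1 1)|]; try lra.
    - rewrite ms; nra.
    - assert (0 < s / x)%R by now apply Rdiv_lt_0_compat.
      rewrite <- RtoC_div, <- RtoC_plus, Cmod_R, Rabs_pos_eq by lra; lra.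
    - rewrite ms; unfold h; apply Req_le; field; lra. }
  assert (hg := bose_sub_inv_bound x x0); fold g in hg.
  assert (g2 : (Rabs g <= 2)%R).
  { apply Rle_trans with (1 := hg).
    apply Rmult_le_reg_r with (1 + x)%R; [lra|].
    unfold Rdiv; rewrite Rmult_assoc, Rinv_l; lra. }
  apply Rabs_le_between in g2.
  replace (shift_ratio x (w * RtoC s))
    with (1 + w * RtoC (s * g)
          + (shift_ratio x (w * RtoC s) - 1 - w * RtoC s * RtoC g))
    by (rewrite RtoC_mult; ring).
  replace (Rshift_ratio x s)
    with (1 + (s * g + (Rshift_ratio x s - 1 - s * g)))%R by ring.
  rewrite Rmult_assoc; apply hK.
  - replace (4 * h)%R with (s ^ 2 * (2 / (1 + x)) ^ 2)%R
      by (unfold h; field; lra).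
    rewrite Rpow_mult_distr; apply Rmult_le_compat_l; [apply pow2_ge_0|].
    rewrite <- (pow2_abs g); apply pow_incr; split; [apply Rabs_pos | exact hg].
  - eapply Rle_trans; [exact main|]; unfold B; nra.
  - eapply Rle_trans; [exact real|]; unfold B; nra.
  - nra.
  - eapply Rle_trans; [exact real|]; nra.
Qed.

(** * Product identities *)

Lemma Rcpow_exp (s : R) (z : C) : Rcpow (exp (- s)) z = Cexp (- (z * RtoC s)).
Proof. unfold Rcpow; rewrite ln_exp, RtoC_opp; f_equal; ring. Qed.

(** The exponent on the right is a difference of consecutive values, so that the
    exponentials telescope in the product over [k]. *)
Lemma factor_identity (w : C) (s : R) (k : nat) :
  (forall n : nat, w <> RtoC (- INR n)) -> (0 < s)%R ->
  let q := exp (- s) in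
  (1 - RtoC q * RtoC (q ^ k)) * (gamma_factor w k * quotient_factor w s k)
  = (1 - Rcpow q w * RtoC (q ^ S k))
    * Cexp (- w * RtoC (ln (1 - q * q ^ S k) - ln (1 - q * q ^ k))).
Proof.
  intros hw hs q.
  destruct (one_plus_div_lower w hw) as [c [c0 hc]].
  assert (den : 1 + w / RtoC (INR (S k)) <> 0)
    by (apply Cmod_gt_0; generalize (hc k); lra).
  assert (j1 := INR_S_ge_1 k).
  unfold gamma_factor, quotient_factor; cbv zeta.
  set (j := INR (S k)) in *.
  set (x := (j * s)%R).
  assert (x0 : (0 < x)%R) by (apply Rmult_lt_0_compat; lra).
  set (X := exp (- x)).
  assert (X0 : (0 < X)%R) by apply exp_pos.
  assert (X1 : (X < 1)%R)
    by (unfold X; rewrite <- exp_0; apply exp_increasing; lra).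
  assert (q0 : (0 < q)%R) by apply exp_pos.
  assert (q1 : (q < 1)%R)
    by (unfold q; rewrite <- exp_0; apply exp_increasing; lra).
  assert (qk : (q * q ^ k = X)%R).
  { change (q * q ^ k)%R with (q ^ S k)%R; unfold X, x, j, q.
    rewrite <- Rpower_pow by apply exp_pos.
    unfold Rpower; rewrite ln_exp; f_equal; ring. }
  assert (hb : bose x = (X / (1 - X))%R).
  { unfold bose.
    replace (exp x) with (/ X)%R
      by (unfold X; rewrite exp_Ropp, Rinv_inv; reflexivity).
    field; lra. }
  replace (q * q ^ S k)%R with (q * X)%R by (simpl; rewrite qk; ring).
  replace (q ^ S k)%R with X by (simpl; now rewrite qk).
  rewrite <- RtoC_mult, qk.
  assert (lnid : (ln (1 + / j) + ln (Rshift_ratio x s)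
                  = ln (1 - q * X) - ln (1 - X))%R).
  { assert (0 < / j)%R by (apply Rinv_0_lt_compat; lra).
    assert (qX : (0 < 1 - q * X)%R) by nra.
    assert (e : (Rshift_ratio x s = (1 - q * X) / ((1 - X) * (1 + / j)))%R).
    { unfold Rshift_ratio; rewrite hb; fold q; unfold x; field.
      repeat split; lra. }
    rewrite e, ln_div by nra.
    rewrite ln_mult by lra; ring. }
  replace (Rcpow q w) with (Cexp (- (w * RtoC s)))
    by (symmetry; apply Rcpow_exp).
  unfold Rcpow.
  replace (_ * _) with
    ((1 - RtoC X) * ((1 + w / RtoC j) * shift_ratio x (w * RtoC s))
     * (Cexp (- w * RtoC (ln (1 + / j)))
        * Cexp (- w * RtoC (ln (Rshift_ratio x s))))) by ring.
  rewrite <- Cexp_plus, <- Cmult_plus_distr_l, <- RtoC_plus, lnid.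
  f_equal; unfold shift_ratio; rewrite hb.
  replace (w * RtoC s / RtoC x) with (w / RtoC j).
  2:{ unfold x; rewrite RtoC_mult; field; split; apply RtoC_neq_0; lra. }
  rewrite RtoC_div, RtoC_minus by lra.
  assert (jC : RtoC j <> 0) by (apply RtoC_neq_0; lra).
  assert (XC : 1 - RtoC X <> 0)
    by (rewrite <- RtoC_minus; apply RtoC_neq_0; lra).
  field; repeat split; try exact jC; try exact XC.
  intros e; apply den.
  replace (1 + w / RtoC j) with ((RtoC j + w) / RtoC j)
      by (field; exact jC).
  rewrite e; field; exact jC.
Qed.

(** The right side has one more factor than the left because the factor with
    [k = 0] of the q-Pochhammer symbol of [q ^ w] is the numerator of the
    prefactor [w]_q. *)
Lemma product_identity (w : C) (s : R) (n : nat) :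
  (forall n : nat, w <> RtoC (- INR n)) -> (0 < s)%R ->
  let q := exp (- s) in
  Cprod (fun k => 1 - RtoC q * RtoC (q ^ k)) n * Cprod (gamma_factor w) n
    * Cprod (quotient_factor w s) n * (1 - Rcpow q w)
  = Cprod (fun k => 1 - Rcpow q w * RtoC (q ^ k)) (S n)
    * Cexp (- w * RtoC (ln (1 - q * q ^ n) - ln (1 - q))).
Proof.
  intros hw hs q; induction n as [|n IH].
  { simpl; rewrite Rmult_1_r, Rminus_diag, Cmult_0_r, Cexp_0; ring. }
  change (Cprod (fun k => 1 - Rcpow q w * RtoC (q ^ k)) (S (S n)))
    with (Cprod (fun k => 1 - Rcpow q w * RtoC (q ^ k)) (S n)
          * (1 - Rcpow q w * RtoC (q ^ S n))).
  change (Cprod ?f (S n) * Cprod ?g (S n) * Cprod ?h (S n) * ?c)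
    with ((Cprod f n * f n) * (Cprod g n * g n) * (Cprod h n * h n) * c).
  cbv beta.
  replace (_ * _) with
    (Cprod (fun k => 1 - RtoC q * RtoC (q ^ k)) n * Cprod (gamma_factor w) n
       * Cprod (quotient_factor w s) n * (1 - Rcpow q w)
     * ((1 - RtoC q * RtoC (q ^ n))
        * (gamma_factor w n * quotient_factor w s n))) by ring.
  rewrite IH; unfold q at 5 6; rewrite factor_identity by assumption; fold q.
  replace (ln (1 - q * q ^ S n) - ln (1 - q))%R
    with ((ln (1 - q * q ^ n) - ln (1 - q))
          + (ln (1 - q * q ^ S n) - ln (1 - q * q ^ n)))%R by ring.
  rewrite RtoC_plus, Cmult_plus_distr_l, Cexp_plus; ring.
Qed.

Lemma qpoch_dominated (a : C) (q : R) : (0 < q < 1)%R ->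
  dominated (fun k => 1 - a * RtoC (q ^ k))
    (fun k => - (Cmod a / (1 - q)) * q ^ k)%R.
Proof.
  intros hq k.
  replace (1 - a * RtoC (q ^ k) - 1) with (- (a * RtoC (q ^ k))) by ring.
  rewrite Cmod_opp, Cmod_mult, Cmod_R, Rabs_pos_eq by (apply pow_le; lra).
  simpl; apply Req_le; field; lra.
Qed.

Lemma qpoch_majorant_le (a : C) (q : R) (k : nat) : (0 < q < 1)%R ->
  (- (Cmod a / (1 - q)) * q ^ k <= 0)%R.
Proof.
  intros hq.
  assert (0 <= Cmod a / (1 - q))%R
    by (apply Rdiv_le_0_compat; [apply Cmod_ge_0 | lra]).
  assert (0 <= q ^ k)%R by (apply pow_le; lra).
  nra.
Qed.

Lemma qpoch_converges (a : C) (q : R) : (0 < q < 1)%R ->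
  is_Clim (Cprod (fun k => 1 - a * RtoC (q ^ k))) (qPochhammer a q).
Proof.
  intros hq.
  destruct (Cprod_converges _ _ 0 (qpoch_dominated a q hq)) as [l hl];
    [intros k; now apply qpoch_majorant_le|].
  unfold qPochhammer; now rewrite (Cinfprod_eq _ _ hl).
Qed.

Lemma qpoch_q_neq_0 (q : R) : (0 < q < 1)%R -> qPochhammer (RtoC q) q <> 0.
Proof.
  intros hq.
  apply (Cprod_lim_neq_0 _ _ 0 (1 - q) _ (qpoch_dominated (RtoC q) q hq));
    [intros k; now apply qpoch_majorant_le | lra | | now apply qpoch_converges].
  intros k.
  rewrite <- RtoC_mult, <- RtoC_minus, Cmod_R.
  apply Rle_trans with (2 := Rle_abs _).
  assert (0 < q ^ k)%R by (apply pow_lt; lra).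
  assert (q ^ k <= 1)%R.
  { rewrite <- (pow1 k); apply pow_incr; lra. }
  nra.
Qed.

Lemma gamma_product_dominated (w : C) :
  exists B, dominated (gamma_factor w) B /\ forall k, (B k <= 0)%R.
Proof.
  destruct (gamma_factor_bound w) as [K [K0 hK]].
  exists (fun n => - (2 * K / INR (S n)))%R; split.
  - intros k; eapply Rle_trans; [apply hK|].
    assert (j1 := INR_S_ge_1 k).
    rewrite (S_INR (S k)); set (j := INR (S k)) in *.
    replace (- (2 * K / (j + 1)) - - (2 * K / j))%R
      with (K * (2 / (j * (j + 1))))%R by (field; lra).
    apply Rmult_le_compat_l; [exact K0|].
    apply Rmult_le_reg_r with (j ^ 2 * (j + 1))%R; [simpl; nra|].
    replace ((/ j) ^ 2 * (j ^ 2 * (j + 1)))%R with (j + 1)%R by (field; lra).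
    replace (2 / (j * (j + 1)) * (j ^ 2 * (j + 1)))%R with (2 * j)%R
      by (field; lra).
    lra.
  - intros k; assert (j1 := INR_S_ge_1 k).
    assert (0 <= 2 * K / INR (S k))%R by (apply Rdiv_le_0_compat; lra); lra.
Qed.

Lemma gamma_product_converges (w : C) :
  exists l, is_Clim (Cprod (gamma_factor w)) l.
Proof.
  destruct (gamma_product_dominated w) as [B [hB hb]].
  exact (Cprod_converges _ B 0 hB hb).
Qed.

Lemma gamma_product_neq_0 (w l : C) :
  (forall n : nat, w <> RtoC (- INR n)) ->
  is_Clim (Cprod (gamma_factor w)) l -> l <> 0.
Proof.
  intros hw hl.
  destruct (one_plus_div_lower w hw) as [c [c0 hc]].
  destruct (gamma_product_dominated w) as [B [hB hb]].
  apply (Cprod_lim_neq_0 (gamma_factor w) B 0 (c * exp (- Cmod w)) l hB hb);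
    [apply Rmult_lt_0_compat; [exact c0 | apply exp_pos] | | exact hl].
  intros k; unfold gamma_factor, Rcpow; rewrite Cmod_mult, Cmod_Cexp.
  apply Rmult_le_compat; [lra | left; apply exp_pos | apply hc | apply exp_mono].
  rewrite re_scal_r, re_opp.
  assert (j1 := INR_S_ge_1 k).
  assert (i0 : (0 < / INR (S k))%R) by (apply Rinv_0_lt_compat; lra).
  assert (i1 : (/ INR (S k) <= 1)%R)
    by (rewrite <- Rinv_1; apply Rinv_le_contravar; lra).
  assert (l1 : (ln (1 + / INR (S k)) <= 1)%R).
  { apply Rle_trans with (ln (exp 1)); [|rewrite ln_exp; apply Rle_refl].
    apply ln_le; [lra|]; generalize (exp_ineq1_le 1); lra. }
  assert (l0 : (0 <= ln (1 + / INR (S k)))%R)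
    by (rewrite <- ln_1; apply ln_le; lra).
  generalize (re_le_Cmod w) (Cmod_ge_0 w); intros hr h0.
  apply Rabs_le_between in hr.
  set (L := ln (1 + / INR (S k))) in *; clearbody L; clear j1 i0 i1.
  assert (0 <= Cmod w * (1 - L))%R by (apply Rmult_le_pos; lra).
  assert (0 <= L * (Cmod w - Re w))%R by (apply Rmult_le_pos; lra).
  lra.
Qed.

Lemma is_Clim_Cexp_scal (a : C) (L : nat -> R) (l : R) :
  is_lim_seq L l ->
  is_Clim (fun n => Cexp (a * RtoC (L n))) (Cexp (a * RtoC l)).
Proof.
  intros hL; split.
  - apply (is_lim_seq_continuous (fun t => Re (Cexp (a * RtoC t))) L l);
      [|exact hL].
    apply continuity_pt_filterlim,
      (ex_derive_continuous (V := R_NormedModule)).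
    destruct a as [a1 a2]; unfold Cexp; simpl; auto_derive; trivial.
  - apply (is_lim_seq_continuous (fun t => Im (Cexp (a * RtoC t))) L l);
      [|exact hL].
    apply continuity_pt_filterlim,
      (ex_derive_continuous (V := R_NormedModule)).
    destruct a as [a1 a2]; unfold Cexp; simpl; auto_derive; trivial.
Qed.

(** Limit of [product_identity]: there the last exponential tends to
    (1 - q) ^ w. *)
Lemma qGamma_Gamma (w rho : C) (s : R) :
  (forall n : nat, w <> RtoC (- INR n)) -> (0 < s)%R ->
  let q := exp (- s) in
  is_Clim (Cprod (quotient_factor w s)) rho ->
  rho <> 0 -> 1 - Rcpow q w <> 0 ->
  qGamma q w
  = Gamma w * / ((1 - Rcpow q w) / (w * (1 - RtoC q)) * rho) /\ Gamma w <> 0.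
Proof.
  intros hw hs q hrho rho0 qw0.
  assert (q0 : (0 < q)%R) by apply exp_pos.
  assert (q1 : (q < 1)%R)
    by (unfold q; rewrite <- exp_0; apply exp_increasing; lra).
  destruct (gamma_product_converges w) as [l hl].
  assert (l0 := gamma_product_neq_0 w l hw hl).
  assert (w0 : w <> 0)
    by (intros e; apply (hw O); rewrite e; simpl; now rewrite Ropp_0).
  assert (hG : Gamma w = / (w * l)).
  { unfold Gamma; f_equal; f_equal; exact (Cinfprod_eq _ _ hl). }
  assert (qq := qpoch_converges (RtoC q) q (conj q0 q1)).
  assert (qz := qpoch_converges (Rcpow q w) q (conj q0 q1)).
  assert (qq0 := qpoch_q_neq_0 q (conj q0 q1)).
  assert (hL : is_lim_seq (fun n => ln (1 - q * q ^ n) - ln (1 - q))%R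
                 (- ln (1 - q))%R).
  { replace (- ln (1 - q))%R with (ln (1 - q * 0) - ln (1 - q))%R
      by (rewrite Rmult_0_r, Rminus_0_r, ln_1; ring).
    apply is_lim_seq_minus'; [|apply is_lim_seq_const].
    refine (is_lim_seq_continuous (fun t => ln (1 - q * t))%R
              (fun n => q ^ n)%R 0%R _ _).
    - apply continuity_pt_filterlim,
        (ex_derive_continuous (V := R_NormedModule)
           (fun t => ln (1 - q * t))%R 0%R).
      auto_derive; rewrite Rmult_0_r; lra.
    - apply is_lim_seq_geom; rewrite Rabs_pos_eq; lra. }
  apply (is_Clim_Cexp_scal (- w)) in hL.
  assert (lim1 := is_Clim_mult _ _ _ _
    (is_Clim_mult _ _ _ _ (is_Clim_mult _ _ _ _ qq hl) hrho)
    (is_Clim_const (1 - Rcpow q w))).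
  assert (lim2 := is_Clim_mult _ _ _ _ (is_Clim_incr_1 _ _ qz) hL).
  assert (key := is_Clim_unique _ _ _
    (is_Clim_ext _ _ _ (fun n => product_identity w s n hw hs) lim1) lim2).
  clear lim1 lim2 hL qq qz hl hrho.
  assert (pw : Cexp (- w * RtoC (- ln (1 - q)))
               = Rcpow (1 - q) (w - 1) * (1 - RtoC q)).
  { unfold Rcpow.
    replace (1 - RtoC q) with (Cexp (RtoC (ln (1 - q)))).
    2:{ rewrite Cexp_RtoC, exp_ln by lra; apply RtoC_minus. }
    rewrite <- Cexp_plus; f_equal; rewrite RtoC_opp; ring. }
  rewrite pw in key.
  assert (q1C : 1 - RtoC q <> 0)
    by (rewrite <- RtoC_minus; apply RtoC_neq_0; lra).
  assert (wl0 : w * l <> 0) by now apply Cmult_neq_0.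
  split.
  2:{ rewrite hG; apply Cmod_gt_0; rewrite Cmod_inv by exact wl0.
      now apply Rinv_0_lt_compat, Cmod_gt_0. }
  rewrite hG; unfold qGamma.
  fold q in key.
  replace (Rcpow (1 - q) (w - 1) * qPochhammer (Rcpow q w) q)
    with (qPochhammer (RtoC q) q * l * rho * (1 - Rcpow q w) / (1 - RtoC q)).
  2:{ rewrite key; field; exact q1C. }
  field; repeat split; assumption.
Qed.

(** * The rate of convergence *)

Lemma exp_sub_1_le (t : R) : (0 <= t <= 1)%R -> (exp t - 1 <= 3 * t)%R.
Proof.
  intros [t0 t1]; destruct t0 as [t0 | <-]; [|rewrite exp_0; lra].
  generalize (expm1_sub_le t t0) exp_le_3 (exp_mono t 1 t1); nra.
Qed.

Lemma quotient_product_limit (w : C) :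
  (forall n : nat, w <> RtoC (- INR n)) ->
  exists K s0 : R, (0 <= K)%R /\ (0 < s0)%R /\
    forall s, (0 < s <= s0)%R ->
      exists rho, is_Clim (Cprod (quotient_factor w s)) rho /\
        (Cmod (rho - 1) <= K * s)%R.
Proof.
  intros hw.
  destruct (quotient_factor_bound w hw) as [K [s0 [K0 [s00 hK]]]].
  exists (3 * K)%R, (Rmin s0 (/ (K + 1))); split; [lra|]; split.
  { apply Rmin_glb_lt; [exact s00 | apply Rinv_0_lt_compat; lra]. }
  intros s [sp sle].
  assert (ss0 : (s <= s0)%R) by (eapply Rle_trans; [exact sle | apply Rmin_l]).
  assert (sK : (s * (K + 1) <= 1)%R).
  { replace 1%R with (/ (K + 1) * (K + 1))%R at 2 by (field; lra).
    apply Rmult_le_compat_r; [lra|].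
    eapply Rle_trans; [exact sle | apply Rmin_r]. }
  set (B := fun n : nat => (- (K * s / (1 + INR n * s)))%R).
  (* [s / (1 + j s) ^ 2] is at most
     [1 / (1 + (j - 1) s) - 1 / (1 + j s)], so the sum over [j] of
     [s ^ 2 / (1 + j s) ^ 2] is only of order [s] *)
  assert (hB : dominated (quotient_factor w s) B).
  { intros k; eapply Rle_trans; [apply hK; split; assumption|].
    unfold B; rewrite S_INR.
    assert (p : (0 <= INR k * s)%R)
      by (apply Rmult_le_pos; [apply pos_INR | lra]).
    replace ((INR k + 1) * s)%R with (INR k * s + s)%R by ring.
    set (y := (INR k * s)%R) in *.
    replace (_ - _)%R with (K * (s ^ 2 / ((1 + y) * (1 + (y + s)))))%R
      by (field; lra).
    apply Rmult_le_compat_l; [exact K0|].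
    apply Rmult_le_compat_l; [apply pow2_ge_0|].
    apply Rinv_le_contravar; nra. }
  assert (hb : forall k, (B k <= 0)%R).
  { intros k; unfold B.
    assert (p : (0 <= INR k * s)%R)
      by (apply Rmult_le_pos; [apply pos_INR | lra]).
    assert (0 <= K * s / (1 + INR k * s))%R by (apply Rdiv_le_0_compat; nra).
    lra. }
  destruct (Cprod_converges _ B 0 hB hb) as [rho hrho].
  exists rho; split; [exact hrho|].
  eapply Rle_trans; [apply (Cprod_lim_sub_1_le _ B 0 _ hB hb hrho)|].
  replace (0 - B 0%nat)%R with (K * s)%R by (unfold B; simpl; field; lra).
  eapply Rle_trans; [apply exp_sub_1_le; nra|]; lra.
Qed.

(** The linear terms [w s] of [1 - q ^ w] and of [w (1 - q)] agree, so the
    quotient is [1] up to second order terms divided by [w (1 - q)]. *)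
Lemma qnumber_bound (w : C) (s : R) :
  w <> 0 -> (0 < s)%R -> (s * (Cmod w + 1) <= 1)%R ->
  (Cmod ((1 - Rcpow (exp (- s)) w) / (w * (1 - RtoC (exp (- s)))) - 1)
     <= 6 * (Cmod w + 1) * s)%R.
Proof.
  intros w0 s0 sW.
  set (W := Cmod w) in *.
  assert (W0 : (0 < W)%R) by now apply Cmod_gt_0.
  rewrite Rcpow_exp.
  assert (E : forall d : C, (Cmod d <= 1)%R ->
    (Cmod (Cexp (- d) - 1 + d) <= 3 * Cmod d ^ 2)%R).
  { intros d hd; generalize (Cexp_taylor1 (- d)); rewrite Cmod_opp.
    replace (Cexp (- d) - 1 - - d) with (Cexp (- d) - 1 + d) by ring.
    intros h; apply Rle_trans with (1 := h); rewrite Rmult_comm.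
    apply Rmult_le_compat_r; [apply pow_le, Cmod_ge_0|].
    apply Rle_trans with (2 := exp_le_3), exp_mono, hd. }
  assert (ms : Cmod (RtoC s) = s) by (rewrite Cmod_R; apply Rabs_pos_eq; lra).
  assert (E1 := E (w * RtoC s)); assert (E2 := E (RtoC s)).
  rewrite Cmod_mult, ms in E1; rewrite ms in E2; fold W in E1.
  specialize (E1 ltac:(nra)); specialize (E2 ltac:(nra)).
  rewrite <- RtoC_opp, Cexp_RtoC in E2.
  set (Q := Cexp (- (w * RtoC s))) in *.
  set (q := exp (- s)) in *.
  assert (hq : (s / 2 <= 1 - q)%R).
  { assert (q * (1 + s) <= 1)%R.
    { apply Rle_trans with (q * exp s)%R.
      - apply Rmult_le_compat_l; [left; apply exp_pos | apply exp_ineq1_le].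
      - unfold q; rewrite <- exp_plus, Rplus_opp_l, exp_0; lra. }
    nra. }
  assert (q1C : 1 - RtoC q <> 0)
    by (rewrite <- RtoC_minus; apply RtoC_neq_0; lra).
  replace (_ - 1) with
    ((- (Q - 1 + w * RtoC s) + w * (RtoC q - 1 + RtoC s)) / (w * (1 - RtoC q)))
    by (field; split; assumption).
  rewrite Cmod_div by now apply Cmult_neq_0.
  rewrite Cmod_mult, <- (RtoC_minus 1 q), (Cmod_R (1 - q)), (Rabs_pos_eq (1 - q))
    by lra.
  fold W.
  apply Rmult_le_reg_r with (W * (1 - q))%R; [nra|].
  unfold Rdiv; rewrite Rmult_assoc, Rinv_l, Rmult_1_r by nra.
  eapply Rle_trans; [apply Cmod_triangle|].
  rewrite Cmod_opp, Cmod_mult; fold W.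
  apply Rle_trans with (3 * (W * s) ^ 2 + W * (3 * s ^ 2))%R.
  - apply Rplus_le_compat; [exact E1|].
    apply Rmult_le_compat_l; [lra | exact E2].
  - replace (3 * (W * s) ^ 2 + W * (3 * s ^ 2))%R
      with (6 * (W + 1) * s * (W * (s / 2)))%R by field.
    apply Rmult_le_compat_l; nra.
Qed.

Lemma Cinv_sub_1_le (z : C) : (Cmod (z - 1) <= / 2)%R ->
  z <> 0 /\ (Cmod (/ z - 1) <= 2 * Cmod (z - 1))%R.
Proof.
  intros h.
  assert (low : (/ 2 <= Cmod z)%R).
  { generalize (Cmod_sub_le z (z - 1)).
    replace (z - (z - 1)) with (RtoC 1) by ring; rewrite Cmod_1; lra. }
  assert (z0 : z <> 0) by (apply Cmod_gt_0; lra).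
  split; [exact z0|].
  replace (/ z - 1) with (- (z - 1) / z) by (field; exact z0).
  rewrite Cmod_div, Cmod_opp by exact z0.
  apply Rmult_le_reg_r with (Cmod z); [lra|].
  unfold Rdiv; rewrite Rmult_assoc, Rinv_l by lra.
  generalize (Cmod_ge_0 (z - 1)); nra.
Qed.

Theorem theorem3 (w : C) (hw : forall n : nat, w <> RtoC (- INR n)) :
  exists r : R -> C,
    is_bigO (at_right 0) r (fun tau => tau) /\
    at_right 0 (fun tau : R =>
      qGamma (exp (- (PI * tau))) w = Gamma w * (1 + r tau)).
Proof.
  assert (w0 : w <> 0)
    by (intros e; apply (hw O); rewrite e; simpl; now rewrite Ropp_0).
  destruct (quotient_product_limit w hw) as [K [s0 [K0 [s00 hK]]]].
  set (W := Cmod w); assert (W0 : (0 <= W)%R) by apply Cmod_ge_0.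
  (* [M s] bounds the distance to [1] of prefactor times product *)
  set (M := (12 * (W + 1) + K)%R).
  assert (M0 : (0 < M)%R) by (unfold M; lra).
  assert (small : (0 < Rmin s0 (/ (2 * M)))%R)
    by (apply Rmin_glb_lt; [exact s00 | apply Rinv_0_lt_compat; lra]).
  assert (main : forall s, (0 < s <= Rmin s0 (/ (2 * M)))%R ->
    qGamma (exp (- s)) w
      = Gamma w * (1 + (qGamma (exp (- s)) w / Gamma w - 1)) /\
    (Cmod (qGamma (exp (- s)) w / Gamma w - 1) <= 2 * M * s)%R).
  { intros s [sp sle].
    assert (ss0 : (s <= s0)%R) by (eapply Rle_trans; [exact sle | apply Rmin_l]).
    assert (sM : (M * s <= / 2)%R).
    { replace (/ 2)%R with (M * / (2 * M))%R by (field; lra).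
      apply Rmult_le_compat_l; [lra|].
      eapply Rle_trans; [exact sle | apply Rmin_r]. }
    destruct (hK s (conj sp ss0)) as [rho [hrho rho1]].
    assert (z1 := qnumber_bound w s w0 sp); fold W in z1.
    specialize (z1 ltac:(unfold M in sM; nra)).
    set (z := (1 - Rcpow (exp (- s)) w) / (w * (1 - RtoC (exp (- s))))) in *.
    destruct (Cinv_sub_1_le z) as [zn0 _]; [unfold M in sM; nra|].
    destruct (Cinv_sub_1_le rho) as [rho0 _]; [unfold M in sM; nra|].
    assert (qw0 : 1 - Rcpow (exp (- s)) w <> 0).
    { intros e; apply zn0; unfold z; rewrite e; unfold Cdiv; ring. }
    assert (rho2 : (Cmod rho <= 2)%R).
    { replace rho with ((rho - 1) + 1) by ring.
      eapply Rle_trans; [apply Cmod_triangle|]; rewrite Cmod_1.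
      unfold M in sM; nra. }
    assert (zr : (Cmod (z * rho - 1) <= M * s)%R).
    { replace (z * rho - 1) with ((z - 1) * rho + (rho - 1)) by ring.
      eapply Rle_trans; [apply Cmod_triangle|]; rewrite Cmod_mult.
      assert (Cmod (z - 1) * Cmod rho <= 6 * (W + 1) * s * 2)%R
        by (apply Rmult_le_compat; try apply Cmod_ge_0; assumption).
      unfold M; lra. }
    destruct (Cinv_sub_1_le (z * rho)) as [_ hinv]; [lra|].
    destruct (qGamma_Gamma w rho s hw sp hrho rho0 qw0) as [eq G0].
    split; [field; exact G0|].
    rewrite eq; fold z.
    replace (Gamma w * / (z * rho) / Gamma w - 1) with (/ (z * rho) - 1)
      by (field; repeat split; assumption).
    eapply Rle_trans; [exact hinv|]; lra. }
  assert (near : forall P : R -> Prop,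
    (forall s, (0 < s <= Rmin s0 (/ (2 * M)))%R -> P s) ->
    at_right 0 (fun tau => P (PI * tau)%R)).
  { intros P hP.
    assert (e0 : (0 < Rmin s0 (/ (2 * M)) / PI)%R)
      by (apply Rdiv_lt_0_compat; [exact small | apply PI_RGT_0]).
    exists (mkposreal _ e0); intros tau hb tp.
    assert (hb' : (Rabs (tau - 0) < Rmin s0 (/ (2 * M)) / PI)%R) by exact hb.
    rewrite Rminus_0_r, Rabs_pos_eq in hb' by lra.
    generalize PI_RGT_0; intros pi0; apply hP; split; [nra|].
    apply Rmult_lt_compat_l with (r := PI) in hb'; [|exact pi0].
    replace (PI * (Rmin s0 (/ (2 * M)) / PI))%R with (Rmin s0 (/ (2 * M)))%R
      in hb' by (field; lra).
    lra. }
  exists (fun tau => qGamma (exp (- (PI * tau))) w / Gamma w - 1); split.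
  - exists (2 * M * PI)%R.
    generalize (near (fun s => (0 < s)%R /\
      (Cmod (qGamma (exp (- s)) w / Gamma w - 1) <= 2 * M * s)%R)).
    intros h; eapply filter_imp; [|apply h; intros s hs; split;
                                    [apply hs | apply main, hs]].
    intros tau [tp ht]; generalize PI_RGT_0; intros pi0.
    rewrite Rabs_pos_eq by nra; lra.
  - apply (near (fun s => qGamma (exp (- s)) w
        = Gamma w * (1 + (qGamma (exp (- s)) w / Gamma w - 1)))).
    intros s hs; apply main, hs.
Qed.
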